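(* Let $p$ be a prime, let $n,r,v \in \mathbb{Z}^+$, and for $1 \le j \le r$ let $v_j$ be an integer with $1 \le v_j \le v$. Let $A_i = \{0,1\} \subset \mathbb{Z}/p^v\mathbb{Z}$ for all $1 \le i \le n$, and let $B_1,\ldots,B_r \subset \mathbb{Z}/p^v\mathbb{Z}$ be nonempty subsets, each having the property that no two distinct elements are congruent modulo $p$. Let $f_1,\ldots,f_r \in (\mathbb{Z}/p^v\mathbb{Z})[t_1,\ldots,t_n]$. Let $$Z = \Big\{x \in \prod_{i=1}^n A_i \;\Big|\; \forall\, 1 \le j \le r,\ f_j(x) \in B_j \pmod{p^{v_j}}\Big\}.$$ (a) Either $Z = \varnothing$ or $$\# Z \ge 2^{\,n-\sum_{j=1}^r (p^{v_j}-\# B_j)\deg(f_j)}.$$ (b) If $f_j(0) = 0 \in B_j$ for all $1\le j\le r$ and $$n > \sum_{j=1}^r (p^{v_j}-\# B_j)\deg(f_j),$$ then there is $x \in Z$ with $x \neq 0$.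
   Context: For a ring $R$, a subset $B \subset R$, an ideal $I$ of $R$ and $x \in R$, ''$x \in B \pmod I$'' means that there is $b \in B$ with $x - b \in I$. Here ''$\pmod{p^{v_j}}$'' refers to the ideal $p^{v_j}(\mathbb{Z}/p^v\mathbb{Z})$ of $\mathbb{Z}/p^v\mathbb{Z}$. The exponent in (a) may be negative; the power is a real number. $\deg$ denotes total degree; the zero polynomial is assigned degree $0$. *)

(* Defs.v *)
From mathcomp Require Import all_boot all_order all_algebra.
From mathcomp Require Import mpoly.
Set Implicit Arguments.
Unset Strict Implicit.
Unset Printing Implicit Defensive.
Import Order.TTheory GRing.Theory Num.Theory.
Local Open Scope ring_scope.

Definition pideal (R : finComNzRingType) (a : R) : {set R} :=
  [set a * c | c : R].

(* "x \in B (mod I)" *)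
Definition inmod (R : finComNzRingType) (B I : {set R}) (x : R) : bool :=
  [exists b in B, x - b \in I].

(* [msize 0 = 0] and [msize f] is 1 + the total degree for f != 0, so this
   assigns degree 0 to the zero polynomial. *)
Definition tdeg (R : comNzRingType) (n : nat) (f : {mpoly R[n]}) : nat :=
  (msize f).-1.

(* Pitfall: 'Z_q denotes Z/qZ only for q > 1, i.e. here for p > 1 and v > 0. *)
Definition solset (p v n r : nat) (v_ : 'I_r -> nat)
    (A : 'I_n -> {set 'Z_(p ^ v)%N}) (B : 'I_r -> {set 'Z_(p ^ v)%N})
    (f : 'I_r -> {mpoly 'Z_(p ^ v)%N[n]}) : {set {ffun 'I_n -> 'Z_(p ^ v)%N}} :=
  [set x : {ffun 'I_n -> 'Z_(p ^ v)%N} |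
    [forall i, x i \in A i] &&
    [forall j, inmod (B j) (pideal (p%:R ^+ v_ j)) (f j).@[x]]].

(* The subtraction is in int, so it is never truncated. *)
Definition defect (p v n r : nat) (v_ : 'I_r -> nat)
    (B : 'I_r -> {set 'Z_(p ^ v)%N})
    (f : 'I_r -> {mpoly 'Z_(p ^ v)%N[n]}) : int :=
  \sum_(j < r) ((p ^ v_ j)%N%:Z - #|B j|%:Z) * (tdeg (f j))%:Z.

(* Main.v *)
Require Import Defs.
From mathcomp Require Import all_boot all_order all_algebra.
From mathcomp Require Import mpoly.
From mathcomp Require Import zify ring.
Set Implicit Arguments.
Unset Strict Implicit.
Unset Printing Implicit Defensive.
Import Order.TTheory GRing.Theory Num.Theory.
Local Open Scope ring_scope.

(* Lift each f_j to an integer-valued function F_j on the cube {0,1}^n =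
   {subsets of 'I_n}, of degree at most deg f_j as a multilinear polynomial, and
   let H be the product over j of the factors F_j - s, where s runs over the
   residues modulo p^(v_j) outside B_j.  It has degree at most the defect D.
   There is an exponent E such that p^(E+1) divides H(x) exactly when x is not
   in Z: the elements of B_j are incongruent modulo p, so leaving out the factors
   s in B_j removes less than p^(v_j) from the p-adic valuation of the product
   over all residues, and nothing at all when F_j(x) is congruent to an element of
   B_j.  Finally, a function of degree at most D on the cube, with values in an
   abelian group, that is not everywhere in a given subgroup (here that of the
   multiples of p^(E+1)) is outside it at no fewer than 2^(n - D) points. *)

(** * Functions on the cube and their multilinear degree *)

(** At the indicator vector of [X], the squarefree monomial in the variables of [W] is 1 if
    [W \subset X] and 0 otherwise, so [c] lists the coefficients of a multilinear polynomial. This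
    form makes sense for values in any commutative monoid. *)
Definition cube_deg_le (T : finType) (V : nmodType) (D : nat) (g : {set T} -> V) :=
  exists2 c : {set T} -> V,
    forall W : {set T}, (D < #|W|)%N -> c W = 0 &
    forall X : {set T}, g X = \sum_(W : {set T} | W \subset X) c W.

(** Möbius inversion by induction on [#|X|]: [c X] is the value at [X] minus the coefficients of the
    proper subsets of [X]. *)
Lemma cube_coef_closed (T : finType) (V : zmodType) (S : zmodClosed V)
    (c : {set T} -> V) (A : {set T}) :
  (forall X : {set T}, X \subset A ->
     \sum_(W : {set T} | W \subset X) c W \in S) ->
  forall X : {set T}, X \subset A -> c X \in S.
Proof.
move=> gS X; have [k] := ubnP #|X|; elim: k X => // k IHk X leXk sXA.
have := gS X sXA; rewrite (bigD1 X) //= rpredDr // rpred_sum // => W /andP[sWX neWX].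
have ltWX : W \proper X by rewrite properEneq neWX.
by apply: IHk; [exact: leq_trans (proper_card ltWX) _ | exact: subset_trans sWX _].
Qed.

(** A subset of a disjoint union is determined by its two traces. With [B] fixed, this gives the
    coefficients of the restriction to a subcube. *)
Lemma sum_subset_setU (T : finType) (V : nmodType) (c : {set T} -> V)
    (A B : {set T}) : [disjoint A & B] ->
  \sum_(W : {set T} | W \subset A :|: B) c W =
  \sum_(W : {set T} | W \subset A) \sum_(U : {set T} | U \subset B) c (W :|: U).
Proof.
move=> dAB; rewrite pair_big /=.
rewrite (reindex_onto (fun WU : {set T} * {set T} => WU.1 :|: WU.2)
   (fun X => (X :&: A, X :&: B))) /=; last first.
  by move=> X sX; rewrite -setIUr; apply/setIidPl.
apply: eq_bigl => -[W U] /=; apply/andP/andP => [[sWU /eqP[eW eU]]|[sW sU]].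
  by rewrite -eW -eU !subsetIr.
split; first exact: setUSS.
have dis (C D E : {set T}) : C \subset A -> D \subset B -> E = C :&: D -> E = set0.
  move=> sC sD ->; apply/eqP; rewrite setI_eq0.
  exact: disjointWl sC (disjointWr sD dAB).
rewrite !setIUl (setIidPl sW) (setIidPl sU) (dis W B (W :&: B)) //.
by rewrite (dis A U (U :&: A)) 1?setIC // setU0 set0U.
Qed.

(* Take W of maximal cardinality with coefficient outside S: on each of the
   2^(n - #|W|) subcubes {T :|: U | T \subset W}, with U disjoint from W, the top
   coefficient is congruent modulo S to that of W, so g leaves S somewhere. *)
Lemma cube_support_ge (T : finType) (V : zmodType) (S : zmodClosed V) (D : nat)
    (g : {set T} -> V) (X0 : {set T}) :
  cube_deg_le D g -> g X0 \notin S ->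
  (2 ^ (#|T| - D) <= #|[set X | g X \notin S]|)%N.
Proof.
move=> [c c0 gE] gX0.
have [W0 cW0] : exists W0, c W0 \notin S.
  apply/existsP; apply: contraNT gX0 => /existsPn cS.
  by rewrite gE rpred_sum // => W _; have := cS W; rewrite negbK.
case: (@arg_maxnP _ W0 (fun W => c W \notin S) (fun W => #|W|) cW0) => W cW maxW.
have leWD : (#|W| <= D)%N.
  by rewrite leqNgt; apply: contraNN cW => /c0->; rewrite rpred0.
have gU (U : {set T}) : U \subset ~: W ->
    exists2 X : {set T}, g X \notin S & X :\: W = U.
  rewrite subsetC => sUW.
  have dWU : [disjoint W & U] by rewrite disjoints_subset.
  suff [X sXW gX] : exists2 X : {set T}, X \subset W & g (X :|: U) \notin S.
    exists (X :|: U) => //; rewrite setDUl.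
    move: sXW; rewrite -setD_eq0 => /eqP->; rewrite set0U.
    by apply/setDidPl; rewrite disjoint_sym.
  apply/exists_inP; apply: contraNT cW => /exists_inPn gS.
  (* The coefficients of the restriction of [g] to the subcube of the sets [X :|: U] with
     [X \subset W]. *)
  pose c' Y := \sum_(Y' : {set T} | Y' \subset U) c (Y :|: Y').
  have c'S : c' W \in S.
    apply: (@cube_coef_closed _ _ _ c' W) => // X sXW.
    have := gS X sXW; rewrite negbK gE sum_subset_setU //.
    exact: disjointWl sXW dWU.
  (* Every term of [c' W] other than [c W] has an index larger than [W], hence lies in [S] by
     maximality; so [c W] would lie in [S] too. *)
  rewrite /c' (bigD1 set0) ?sub0set //= setU0 rpredDr // in c'S.
  rewrite rpred_sum // => Y /andP[sYU nzY].
  have : (#|W| < #|W :|: Y|)%N.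
    rewrite cardsU (_ : W :&: Y = set0); last first.
      by apply/eqP; rewrite setI_eq0; apply: disjointWr sYU dWU.
    by rewrite cards0 subn0 -addn1 leq_add2l card_gt0.
  by rewrite ltnNge; apply: contraNT => /maxW.
(* By [gU], the map sending [X] to [X :\: W] carries the support onto all subsets of [~: W]. *)
apply: (@leq_trans #|powerset (~: W)|).
  by rewrite card_powerset leq_pexp2l // cardsCs setCK leq_sub2l.
apply: leq_trans (leq_imset_card (fun X => X :\: W) _).
apply/subset_leq_card/subsetP => U; rewrite powersetE => /gU[X gX <-].
by apply: imset_f; rewrite inE.
Qed.

Lemma cube_deg_le_const (T : finType) (V : nmodType) (a : V) :
  cube_deg_le 0 (fun _ : {set T} => a).
Proof.
exists (fun W => if W == set0 then a else 0) => [W|X].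
  by rewrite card_gt0 => /negPf->.
rewrite (bigD1 set0) ?sub0set //= eqxx big1 ?addr0 // => W /andP[_ /negPf->//].
Qed.

Lemma cube_deg_le_monom (T : finType) (V : nmodType) (a : V) (W : {set T}) :
  cube_deg_le #|W| (fun X : {set T} => if W \subset X then a else 0).
Proof.
exists (fun W' => if W' == W then a else 0) => [W'|X].
  by case: eqP => // ->; rewrite ltnn.
case: ifPn => sWX.
  rewrite (bigD1 W) //= eqxx big1 ?addr0 // => W' /andP[_ /negPf->//].
rewrite big1 // => W'; case: eqP => // ->; by rewrite (negPf sWX).
Qed.

Lemma cube_deg_le_weaken (T : finType) (V : nmodType) (D D' : nat)
    (g : {set T} -> V) : (D <= D')%N -> cube_deg_le D g -> cube_deg_le D' g.
Proof. by move=> leD [c c0 gE]; exists c => // W /(leq_ltn_trans leD)/c0. Qed.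

Lemma cube_deg_leD (T : finType) (V : nmodType) (D : nat) (g h : {set T} -> V) :
  cube_deg_le D g -> cube_deg_le D h -> cube_deg_le D (fun X => g X + h X).
Proof.
move=> [c c0 gE] [d d0 hE]; exists (fun W => c W + d W) => [W ltD|X].
  by rewrite c0 // d0 // addr0.
by rewrite gE hE big_split.
Qed.

Lemma cube_deg_le_sum (T : finType) (V : nmodType) (D : nat) (I : eqType)
    (s : seq I) (g : I -> {set T} -> V) :
  (forall i, i \in s -> cube_deg_le D (g i)) ->
  cube_deg_le D (fun X => \sum_(i <- s) g i X).
Proof.
elim: s => [|i s IHs] gD.
  exists (fun=> 0) => // X.
  by rewrite big_nil big1.
have [c c0 gE] : cube_deg_le D (fun X => g i X + \sum_(j <- s) g j X).
  apply: cube_deg_leD; first by apply: gD; rewrite mem_head.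
  by apply: IHs => j js; apply: gD; rewrite in_cons js orbT.
by exists c => // X; rewrite big_cons gE.
Qed.

(** The monomials of [U] and [V] multiply to that of [U :|: V], because variables are idempotent on
    the cube, and [#|U :|: V|] is at most [#|U| + #|V|]. *)
Lemma cube_deg_leM (T : finType) (R : pzSemiRingType) (D E : nat)
    (g h : {set T} -> R) :
  cube_deg_le D g -> cube_deg_le E h -> cube_deg_le (D + E) (fun X => g X * h X).
Proof.
move=> [c c0 gE] [d d0 hE].
exists (fun W => \sum_(UV : {set T} * {set T} | UV.1 :|: UV.2 == W)
                   c UV.1 * d UV.2) => [W ltW|X].
  rewrite big1 // => -[U V] /= /eqP eW; case: (ltnP D #|U|) => [/c0->|leU].
    by rewrite mul0r.
  rewrite [d V]d0 ?mulr0 //; rewrite -eW cardsU in ltW.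
  lia.
rewrite gE hE big_distrl /=; under eq_bigr do rewrite big_distrr /=.
rewrite pair_big /=.
rewrite (partition_big (fun UV : {set T} * {set T} => UV.1 :|: UV.2)
  (fun W => W \subset X)) /=; last by move=> UV; rewrite subUset.
apply: eq_bigr => W sWX; apply: eq_bigl => UV /=.
by case: eqP => [eW|]; rewrite ?andbF // andbT -subUset eW.
Qed.

Lemma cube_deg_le_prod (T I : finType) (R : pzSemiRingType) (P : pred I)
    (D : I -> nat) (g : I -> {set T} -> R) :
  (forall i, P i -> cube_deg_le (D i) (g i)) ->
  cube_deg_le (\sum_(i | P i) D i) (fun X => \prod_(i | P i) g i X).
Proof.
move=> gD; elim: (index_enum I) => [|i s IHs].
  have [c c0 gE] := @cube_deg_le_const T R 1.
  by exists c => [W|X]; rewrite big_nil //; apply: c0.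
have [Pi|nPi] := boolP (P i).
  have [c c0 gE] := cube_deg_leM (gD i Pi) IHs.
  by exists c => [W|X]; rewrite big_cons Pi //; apply: c0.
case: IHs => c c0 gE.
by exists c => [W|X]; rewrite big_cons (negPf nPi) //; apply: c0.
Qed.

(** * Residues of integers and p-adic valuations *)

Lemma val_intr_Zp (q : nat) (z : int) : (1 < q)%N ->
  ((z%:~R : 'Z_q) : nat)%:Z = (z %% q)%Z.
Proof.
move=> q1; rewrite {1}(divz_eq z q) intrD intrM -[(Posz q)%:~R]/(q%:R : 'Z_q).
rewrite pchar_Zp // mulr0 add0r.
have : 0 <= (z %% q)%Z by rewrite modz_ge0 //; lia.
have : (z %% q)%Z < q by apply: ltz_pmod; lia.
case: (z %% q)%Z => // k ltkq _;
by rewrite -pmulrn val_Zp_nat // modn_small //; lia.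
Qed.

Lemma intr_Zp_eq0 (q : nat) (z : int) : (1 < q)%N ->
  (z%:~R == 0 :> 'Z_q) = (q %| z)%Z.
Proof.
move=> q1; apply/eqP/dvdz_mod0P; rewrite -val_intr_Zp //; first by move->.
by case=> z0; apply: val_inj.
Qed.

Lemma dvdz_intr_Zp (q d : nat) (z : int) : (1 < q)%N -> (d %| q)%N ->
  (d %| z)%Z = (d %| (z%:~R : 'Z_q))%N.
Proof.
move=> q1 dq; rewrite {1}(divz_eq z q) -val_intr_Zp //.
by rewrite rpredDl ?dvdz_mull.
Qed.

Lemma logn_Zp_lt (p w : nat) (u : 'Z_(p ^ w)) : prime p -> (0 < w)%N ->
  (logn p u < w)%N.
Proof.
move=> pp w0; have q1 : (1 < p ^ w)%N by rewrite -(expn0 p) ltn_exp2l ?prime_gt1.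
have ltu : (u < p ^ w)%N by rewrite -[X in (_ < X)%N](Zp_cast q1).
(* The default [logn p 0 = 0] satisfies the bound as well. *)
have [->|u0] := posnP (u : nat); first by rewrite logn0.
by rewrite ltnNge -pfactor_dvdn // gtnNdvd.
Qed.

(** For [m <= w], [p ^ m] divides [z] exactly when it divides the residue; the residue being
    nonzero, its valuation is below [w], so these tests determine that of [z]. *)
Lemma logn_intr_Zp (p w : nat) (z : int) : prime p -> (0 < w)%N ->
  z%:~R != 0 :> 'Z_(p ^ w) -> logn p `|z| = logn p (z%:~R : 'Z_(p ^ w)).
Proof.
move=> pp w0 nz0; have q1 : (1 < p ^ w)%N by rewrite -(expn0 p) ltn_exp2l ?prime_gt1.
set u : 'Z_(p ^ w) := z%:~R.
have u0 : (0 < u)%N by rewrite lt0n; apply: contra nz0 => /eqP u0; apply/eqP/val_inj.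
have z0 : (0 < `|z|)%N by rewrite absz_gt0; apply: contra nz0 => /eqP->.
have dvd m : (m <= w)%N -> (m <= logn p `|z|)%N = (m <= logn p u)%N.
  move=> lemw; rewrite -!pfactor_dvdn //.
  by rewrite -[LHS]/((p ^ m)%N %| z)%Z (@dvdz_intr_Zp (p ^ w)) // dvdn_exp2l.
have ltw := logn_Zp_lt u pp w0.
by apply/eqP; rewrite eqn_leq leqNgt dvd // ltnn /= dvd // ltnW.
Qed.

Lemma logn_absz_prod (p : nat) (I : finType) (P : pred I) (a : I -> int) :
  (forall i, P i -> a i != 0) ->
  logn p `|\prod_(i | P i) a i| = (\sum_(i | P i) logn p `|a i|)%N.
Proof.
(* Nonvanishing is carried through the induction, since [lognM] requires positive factors. *)
move=> a0; suff [] : logn p `|\prod_(i | P i) a i| = (\sum_(i | P i) logn p `|a i|)%N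
    /\ \prod_(i | P i) a i != 0 by [].
elim/big_rec2: _ => [|i m x Pi [<- x0]]; first by rewrite logn1.
by rewrite abszM lognM ?absz_gt0 ?mulf_neq0 ?a0.
Qed.

(** The product is formed in [int] because its divisibility by powers of [p] beyond the modulus
    matters. *)
Definition avoid_prod (q : nat) (C : {set 'Z_q}) (z : int) : int :=
  \prod_(s | s \notin C) (z - (s : nat)%:Z).

(** For [p] prime and [w > 0] this is the p-adic valuation of the factorial of [p ^ w - 1]. *)
Definition avoid_exp (p w : nat) : nat :=
  \sum_(u : 'Z_(p ^ w) | u != 0) logn p u.

(* For every residue r, the valuations of r - s, s != r, add up to
   [avoid_exp p w]; for r in C none of this is lost by omitting the factors
   s in C, which are units, and for r outside C the one factor s = r contributes
   at least w, whereas at most w - 1 is lost, in the only factor s in C that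
   can be congruent to r modulo p. *)
Lemma avoid_prod_dvd (p w : nat) (C : {set 'Z_(p ^ w)}) (z : int) :
  prime p -> (0 < w)%N ->
  {in C &, forall s s' : 'Z_(p ^ w), s = s' %[mod p] -> s = s'} ->
  ((p ^ avoid_exp p w)%N %| avoid_prod C z)%Z /\
  ((p ^ (avoid_exp p w).+1)%N %| avoid_prod C z)%Z = (z%:~R \notin C).
Proof.
move=> pp w0 injC; set r : 'Z_(p ^ w) := z%:~R; set e := avoid_exp p w.
have q1 : (1 < p ^ w)%N by rewrite -(expn0 p) ltn_exp2l ?prime_gt1.
have rsE (s : 'Z_(p ^ w)) : (z - (s : nat)%:Z)%:~R = r - s.
  by rewrite intrB /r -[in RHS](natr_Zp s) pmulrn.
have sumE : e = (\sum_(s | s != r) logn p (r - s)%R)%N.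
  rewrite /e /avoid_exp (reindex_inj (inj_comp (addrI r) oppr_inj)) /=.
  by apply: eq_bigl => s; rewrite subr_eq0 eq_sym.
have logrE s : s != r -> z - (s : nat)%:Z != 0 /\
    logn p `|z - (s : nat)%:Z| = logn p (r - s)%R.
  move=> ner; have nz : (z - (s : nat)%:Z)%:~R != 0 :> 'Z_(p ^ w).
    by rewrite rsE subr_eq0 eq_sym.
  by split; [apply: contraNneq nz => -> | rewrite (logn_intr_Zp pp w0 nz) rsE].
have congr s : (0 < logn p (r - s)%R)%N -> r = s %[mod p].
  rewrite logn_gt0 mem_primes => /and3P[_ _].
  rewrite -rsE -dvdz_intr_Zp ?dvdn_exp // => pz.
  have : (p %| (r : nat)%:Z - (s : nat)%:Z)%Z.
    have -> : (r : nat)%:Z - (s : nat)%:Z =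
        z - (s : nat)%:Z - (z - (r : nat)%:Z) by ring.
    rewrite rpredB // (@dvdz_intr_Zp (p ^ w)) ?dvdn_exp // intrB.
    by rewrite -pmulrn natr_Zp subrr dvdn0.
  by rewrite -eqz_mod_dvd !modz_nat => /eqP[].
have [rC|rC] := boolP (r \in C).
  have nerC s : s \notin C -> s != r by apply: contraNneq => ->.
  have P0 : avoid_prod C z != 0.
    by apply/prodf_neq0 => s sC; have [] := logrE s (nerC s sC).
  have logP : logn p `|avoid_prod C z| = e.
    rewrite logn_absz_prod => [|s sC]; last by have [] := logrE s (nerC s sC).
    rewrite sumE [RHS](bigID (mem C)) /= [X in (X + _)%N]big1 => [|s /andP[ner sC]].
      rewrite add0n.
      apply: eq_big => s; last by move=> sC; have [] := logrE s (nerC s sC).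
      by have [|/nerC->] := boolP (s \in C); rewrite ?andbF.
    apply/eqP; rewrite -leqn0 leqNgt; apply: contra ner => /congr eqrs.
    by apply/eqP/esym/injC.
  rewrite !dvdzE /= !pfactor_dvdn ?absz_gt0 // logP.
  by rewrite leqnn ltnn.
(* The factor at [r] may be 0, where [logn] carries no information; it is split off and treated by
   divisibility alone. *)
have -> : avoid_prod C z = (z - (r : nat)%:Z) *
    \prod_(s | (s \notin C) && (s != r)) (z - (s : nat)%:Z).
  by rewrite /avoid_prod (bigD1 r).
set Q := \prod_(s | _) _.
have Q0 : Q != 0 by apply/prodf_neq0 => s /andP[_ /logrE[]].
have logQ : (e < logn p `|Q| + w)%N.
  rewrite logn_absz_prod => [|s /andP[_ /logrE[]] //].
  set S := (X in (_ < X + w)%N).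
  have -> : e = (\sum_(s in C) logn p (r - s)%R + S)%N.
    rewrite sumE (bigID (mem C)) /=; congr (_ + _)%N.
      by apply: eq_bigl => s; have [->|] := eqVneq s r; rewrite ?(negPf rC).
    apply: eq_big => s; first by rewrite andbC.
    by case/andP=> /logrE[].
  rewrite addnC ltn_add2l.
  have [/existsP[s0 /andP[s0C s0gt]]|/existsPn noS] :=
      boolP [exists s, (s \in C) && (0 < logn p (r - s)%R)%N].
    rewrite (bigD1 s0) // big1 => [|s /andP[sC nes]].
      have := logn_Zp_lt (r - s0)%R pp w0.
      by rewrite -[X in (X < _)%N]addn0.
    apply/eqP; rewrite -leqn0 leqNgt; apply: contra nes => /congr eqrs.
    by apply/eqP/injC => //; rewrite -eqrs; apply: congr.
  rewrite big1 // => s sC; apply/eqP; rewrite -leqn0 leqNgt.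
  by have := noS s; rewrite sC.
suff dvdP : (p ^ e.+1 %| `|((z - (r : nat)%:Z) * Q)%R|)%N.
  by split; rewrite dvdzE //=; apply: dvdn_trans dvdP; apply: dvdn_exp2l.
rewrite abszM (@dvdn_trans (p ^ w * p ^ logn p `|Q|)) //.
  by rewrite -expnD dvdn_exp2l // addnC.
apply: dvdn_mul (pfactor_dvdnn _ _).
rewrite -[X in is_true X]/((p ^ w)%N %| (z - (r : nat)%:Z)%R)%Z.
by rewrite -intr_Zp_eq0 // rsE subrr.
Qed.

(** After division of each [a i] by [p ^ e i], this is Euclid's lemma for the product of the
    quotients. *)
Lemma prod_pfactor_dvd (p : nat) (I : finType) (e : I -> nat) (a : I -> int) :
  prime p -> (forall i, ((p ^ e i)%N %| a i)%Z) ->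
  ((p ^ (\sum_i e i).+1)%N %| \prod_i a i)%Z =
    [exists i, ((p ^ (e i).+1)%N %| a i)%Z].
Proof.
move=> pp /= pa; pose b i := (`|a i| %/ p ^ e i)%N.
have aE i : `|a i|%N = (b i * p ^ e i)%N by rewrite divnK //; have := pa i.
have -> : ((p ^ (\sum_i e i).+1)%N %| \prod_i a i)%Z = (p %| \prod_i b i)%N.
  have -> : ((p ^ (\sum_i e i).+1)%N %| \prod_i a i)%Z =
      (p ^ (\sum_i e i).+1 %| `|(\prod_i a i)%R|)%N by [].
  rewrite (big_morph absz abszM absz1) (eq_bigr _ (fun i _ => aE i)).
  rewrite big_split /= -expn_sum expnS dvdn_pmul2r //.
  by rewrite expn_gt0 prime_gt0.
rewrite Euclid_dvd_prod // big_orE; apply: eq_existsb => i.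
rewrite dvdzE aE /= expnS dvdn_pmul2r //.
by rewrite expn_gt0 prime_gt0.
Qed.

(** * From polynomials modulo [p ^ v] to integer functions on the cube *)

Definition cube_point (R : pzSemiRingType) (n : nat) (X : {set 'I_n}) :
  {ffun 'I_n -> R} := [ffun i => (i \in X)%:R].

(** On 0/1 points a monomial depends only on its support, whose size is at most its degree; the
    coefficients are lifted to their standard representatives. *)
Lemma mpoly_cube_lift (q n : nat) (f : {mpoly 'Z_q[n]}) :
  exists2 F : {set 'I_n} -> int, cube_deg_le (tdeg f) F &
    forall X, (F X)%:~R = f.@[cube_point _ X].
Proof.
pose supp (m : 'X_{1.. n}) := [set i | m i != 0%N].
exists (fun X : {set 'I_n} => \sum_(m <- msupp f)
    if supp m \subset X then ((f@_m : 'Z_q) : nat)%:Z else 0).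
  apply: cube_deg_le_sum => m mf; apply: cube_deg_le_weaken (cube_deg_le_monom _ _).
  apply: (@leq_trans (mdeg m)).
    rewrite mdegE -sum1_card big_mkcond; apply: leq_sum => i _.
    by rewrite inE; case: (m i).
  by have := msize_mdeg_lt mf; rewrite /tdeg; case: (msize f).
move=> X; rewrite mevalE rmorph_sum /=; apply: eq_bigr => m _.
have [sX|/subsetPn[i]] := boolP (supp m \subset X).
  rewrite big1 ?mulr1 => [|i _]; first by rewrite -pmulrn natr_Zp.
  rewrite ffunE; have [mi0|mi] := eqVneq (m i) 0%N; first by rewrite mi0 expr0.
  by rewrite (subsetP sX) ?inE // expr1n.
rewrite inE => mi niX; rewrite (bigD1 i) //= ffunE (negPf niX) expr0n.
by rewrite (negPf mi) mul0r mulr0.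
Qed.

Lemma mem_pideal_intr (q d : nat) (z : int) : (1 < q)%N -> (d %| q)%N ->
  ((z%:~R : 'Z_q) \in pideal d%:R) = (d %| z)%Z.
Proof.
move=> q1 dq; apply/imsetP/idP => [[c _ zE]|/dvdzP[k ->]].
  have : (q %| z - d%:Z * (c : nat)%:Z)%Z.
    rewrite -intr_Zp_eq0 // intrB intrM -!pmulrn natr_Zp zE subrr //.
  move=> qz; have dz : (d %| z - d%:Z * (c : nat)%:Z)%Z by exact: dvdn_trans dq qz.
  by rewrite -[z](subrK (d%:Z * (c : nat)%:Z)) rpredD // dvdz_mulr.
by exists k%:~R => //; rewrite intrM mulrC -pmulrn.
Qed.

Definition residues (q q' : nat) (B : {set 'Z_q}) : {set 'Z_q'} :=
  [set (b : nat)%:R | b : 'Z_q in B].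

(** Turns the condition modulo an ideal of ['Z_q] into membership in a subset of ['Z_d], the form to
    which [avoid_prod_dvd] applies. *)
Lemma inmod_intr (q d : nat) (B : {set 'Z_q}) (z : int) :
  (1 < q)%N -> (1 < d)%N -> (d %| q)%N ->
  inmod B (pideal d%:R) z%:~R = (z%:~R \in residues d B).
Proof.
move=> q1 d1 dq; have mod b :
    ((z%:~R : 'Z_q) - b \in pideal d%:R) = (z%:~R == (b : nat)%:R :> 'Z_d).
  rewrite -{1}[b]natr_Zp pmulrn -intrB mem_pideal_intr //.
  by rewrite -intr_Zp_eq0 // intrB subr_eq0 -pmulrn.
apply/existsP/imsetP => [[b /andP[bB]]|[b bB zE]].
  by rewrite mod => /eqP; exists b.
by exists b; rewrite bB mod zE eqxx.
Qed.

(** As [p] divides [d], reduction modulo [d] preserves classes modulo [p]; it is therefore injective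
    on [B] and keeps its elements incongruent. *)
Lemma residues_incong (p q d : nat) (B : {set 'Z_q}) :
  (1 < q)%N -> (1 < d)%N -> (p %| d)%N -> (d %| q)%N ->
  (forall x y, x \in B -> y \in B -> x != y -> x - y \notin pideal p%:R) ->
  {in residues d B &, forall s s' : 'Z_d, s = s' %[mod p] -> s = s'} /\
  #|residues d B| = #|B|.
Proof.
move=> q1 d1 pd dq incong.
have inj x y : x \in B -> y \in B -> x = y %[mod p] -> x = y.
  move=> xB yB exy; apply/eqP; apply: contraT => nexy.
  have := incong x y xB yB nexy.
  rewrite -[x]natr_Zp -[y]natr_Zp !pmulrn -intrB mem_pideal_intr //.
    by rewrite -eqz_mod_dvd !modz_nat exy eqxx.
  exact: dvdn_trans pd dq.
have mod (b : 'Z_q) : ((b : nat)%:R : 'Z_d) = b %[mod p].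
  by rewrite val_Zp_nat // modn_dvdm.
split=> [_ _ /imsetP[b bB ->] /imsetP[b' b'B ->]|].
  by rewrite !mod => ebb'; rewrite (inj b b').
rewrite card_in_imset // => b b' bB b'B ebb'; apply: inj => //.
by rewrite -mod ebb' mod.
Qed.

Lemma cube_deg_le_avoid_prod (T : finType) (q D : nat) (C : {set 'Z_q})
    (F : {set T} -> int) :
  cube_deg_le D F ->
  cube_deg_le (#|~: C| * D) (fun X => avoid_prod C (F X)).
Proof.
move=> degF; rewrite -sum_nat_const (eq_bigl (fun s => s \notin C)) => [|s]; last first.
  by rewrite inE.
apply: cube_deg_le_prod => s _; apply: cube_deg_leD degF _.
exact: cube_deg_le_weaken (cube_deg_le_const _ _).
Qed.

Lemma cube_point_inj (R : nzRingType) (n : nat) : injective (@cube_point R n).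
Proof.
move=> X Y /ffunP eXY; apply/setP => i; have := eXY i; rewrite !ffunE.
by case: (i \in X); case: (i \in Y) => // /eqP; rewrite 1?[_ == 1]eq_sym oner_eq0.
Qed.

(** * Counting the solution set *)

Lemma mem_solset (p v n r : nat) (v_ : 'I_r -> nat)
    (A : 'I_n -> {set 'Z_(p ^ v)}) (B : 'I_r -> {set 'Z_(p ^ v)})
    (f : 'I_r -> {mpoly 'Z_(p ^ v)[n]}) (F : 'I_r -> {set 'I_n} -> int)
    (X : {set 'I_n}) :
  prime p -> (0 < v)%N -> (forall j, (1 <= v_ j <= v)%N) ->
  (forall i, A i = [set 0; 1]) ->
  (forall j X, (F j X)%:~R = (f j).@[cube_point _ X]) ->
  (cube_point _ X \in solset v_ A B f) =
    [forall j, (F j X)%:~R \in residues (p ^ v_ j) (B j)].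
Proof.
move=> pp v0 vb A01 FE; rewrite inE.
have pX1 w : (0 < w)%N -> (1 < p ^ w)%N by rewrite -(ltn_exp2l 0 w (prime_gt1 pp)).
rewrite (_ : [forall i, _] = true); last first.
  by apply/forallP => i; rewrite A01 !inE ffunE; case: (i \in X); rewrite eqxx ?orbT.
apply: eq_forallb => j; have /andP[w0 wv] := vb j.
by rewrite -FE -natrX inmod_intr ?pX1 // dvdn_exp2l.
Qed.

Lemma solset_cube_point (p v n r : nat) (v_ : 'I_r -> nat)
    (A : 'I_n -> {set 'Z_(p ^ v)}) (B : 'I_r -> {set 'Z_(p ^ v)})
    (f : 'I_r -> {mpoly 'Z_(p ^ v)[n]}) (x : {ffun 'I_n -> 'Z_(p ^ v)}) :
  (forall i, A i = [set 0; 1]) -> x \in solset v_ A B f ->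
  x = cube_point _ [set i | x i == 1].
Proof.
move=> A01; rewrite inE => /andP[/forallP xA _]; apply/ffunP => i.
have := xA i; rewrite A01 ffunE !inE.
by case/orP => /eqP->; rewrite ?eqxx // eq_sym oner_eq0.
Qed.

(** Giving the defect as a natural number [D] also records that it is nonnegative; the truncated
    [n - D] covers the case [n < D]. The point [x0] is where [H] leaves the subgroup. *)
Lemma card_solset_ge (p n r v : nat) (v_ : 'I_r -> nat)
    (A : 'I_n -> {set 'Z_(p ^ v)}) (B : 'I_r -> {set 'Z_(p ^ v)})
    (f : 'I_r -> {mpoly 'Z_(p ^ v)[n]}) (x0 : {ffun 'I_n -> 'Z_(p ^ v)}) :
  prime p -> (0 < v)%N -> (forall j, (1 <= v_ j <= v)%N) ->
  (forall i, A i = [set 0; 1]) ->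
  (forall j x y,
    x \in B j -> y \in B j -> x != y -> x - y \notin pideal p%:R) ->
  x0 \in solset v_ A B f ->
  exists2 D : nat, defect v_ B f = D%:Z & (2 ^ (n - D) <= #|solset v_ A B f|)%N.
Proof.
move=> pp v0 vb A01 incong x0Z.
have [F degF FE] := fin_all_exists2 (fun j => mpoly_cube_lift (f j)).
have pX1 w : (0 < w)%N -> (1 < p ^ w)%N by rewrite -(ltn_exp2l 0 w (prime_gt1 pp)).
pose C j := residues (p ^ v_ j) (B j).
have CP j : {in C j &, forall s s' : 'Z_(p ^ v_ j), s = s' %[mod p] -> s = s'} /\
    #|C j| = #|B j|.
  have /andP[w0 wv] := vb j.
  by apply: residues_incong (incong j); rewrite ?pX1 ?dvdn_exp2l // dvdn_exp.
pose H X := \prod_j avoid_prod (C j) (F j X).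
pose D := (\sum_j #|~: C j| * tdeg (f j))%N.
have degH : cube_deg_le D H.
  by apply: cube_deg_le_prod => j _; apply: cube_deg_le_avoid_prod.
pose E := (\sum_j avoid_exp p (v_ j))%N.
have HZ X : (H X \notin dvdz (p ^ E.+1)%N) = (cube_point _ X \in solset v_ A B f).
  have dvdC j := avoid_prod_dvd (F j X) pp (proj1 (andP (vb j))) (proj1 (CP j)).
  rewrite (mem_solset _ _ pp v0 vb A01 FE).
  rewrite -[H X \in _]/((p ^ E.+1)%N %| H X)%Z prod_pfactor_dvd //; last first.
    by move=> j; have [] := dvdC j.
  rewrite negb_exists; apply: eq_forallb => j.
  by have [_ ->] := dvdC j; rewrite negbK.
exists D.
  rewrite /defect /D rmorph_sum /=; apply: eq_bigr => j _.
  have /andP[w0 wv] := vb j; have [_ cardC] := CP j.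
  rewrite PoszM -cardC; congr (_ * _).
  (* The number of factors of [avoid_prod (C j)] is [p ^ v_ j - #|B j|], because reduction preserves
     the size of [B j]. *)
  have q_card : (p ^ v_ j)%N = (#|C j| + #|~: C j|)%N.
    by rewrite cardsC card_ord Zp_cast ?pX1.
  by rewrite [X in X%:Z - _]q_card PoszD addrAC subrr add0r.
have : (2 ^ (#|'I_n| - D) <= #|[set X | H X \notin dvdz (p ^ E.+1)%N]|)%N.
  apply: (cube_support_ge (X0 := [set i | x0 i == 1]) degH).
  by rewrite HZ -(solset_cube_point A01 x0Z).
rewrite card_ord => /leq_trans; apply.
rewrite -(card_imset _ (@cube_point_inj 'Z_(p ^ v) n)).
by apply/subset_leq_card/subsetP => _ /imsetP[X HX ->]; rewrite inE HZ in HX.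
Qed.

Theorem corollary1p5 (R : realFieldType) (p n r v : nat) (v_ : 'I_r -> nat)
    (A : 'I_n -> {set 'Z_(p ^ v)%N}) (B : 'I_r -> {set 'Z_(p ^ v)%N})
    (f : 'I_r -> {mpoly 'Z_(p ^ v)%N[n]})
    (Z : {set {ffun 'I_n -> 'Z_(p ^ v)%N}})
    (p_prime : prime p) (n_gt0 : (0 < n)%N) (r_gt0 : (0 < r)%N)
    (v_gt0 : (0 < v)%N)
    (v_bound : forall j, (1 <= v_ j <= v)%N)
    (A_def : forall i, A i = [set 0; 1])
    (B_neq0 : forall j, B j != set0)
    (B_incong : forall j x y,
       x \in B j -> y \in B j -> x != y -> x - y \notin pideal p%:R)
    (Z_def : Z = solset v_ A B f) :
  (Z = set0 \/ (2 : R) ^ (n%:Z - defect v_ B f) <= #|Z|%:R) /\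
  ((forall j, (f j).@[(0 : {ffun 'I_n -> 'Z_(p ^ v)%N})] = 0 /\ 0 \in B j) ->
   defect v_ B f < n%:Z ->
   exists2 x, x \in Z & x != 0).
Proof.
rewrite Z_def; split=> [|f0 lt_n].
  have [->|/set0Pn[x0 x0Z]] := eqVneq (solset v_ A B f) set0; first by left.
  right; have [D -> leZ] := card_solset_ge p_prime v_gt0 v_bound A_def B_incong x0Z.
  apply: (@le_trans _ _ (2 ^+ (n - D))); last by rewrite -natrX ler_nat.
  have [leDn|/ltnW leDn] := leqP D n; first by rewrite subzn.
  (* Now [n <= D]: the truncated exponent is 0, and the real power has a nonpositive exponent, hence
     is at most 1. *)
  rewrite -opprB subzn // (eqP leDn) expr0 -exprnN.
  by rewrite invf_le1 ?exprn_ege1 ?exprn_gt0 ?ler1n.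
have Z0 : 0 \in solset v_ A B f.
  rewrite inE; apply/andP; split; apply/forallP; [move=> i | move=> j].
    by rewrite A_def !inE ffunE eqxx.
  have [-> B0] := f0 j; apply/existsP; exists 0; rewrite B0 subrr /=.
  by apply/imsetP; exists 0; rewrite ?mulr0.
have [D defD] := card_solset_ge p_prime v_gt0 v_bound A_def B_incong Z0.
rewrite defD in lt_n; rewrite (cardsD1 (0 : {ffun 'I_n -> 'Z_(p ^ v)})) Z0 => leZ.
(* Since [D < n], the bound [2 ^ (n - D)] is at least 2, which leaves a point of the solution set
   besides 0. *)
have /card_gt0P[x] : (0 < #|solset v_ A B f :\ (0%R : {ffun 'I_n -> 'Z_(p ^ v)})|)%N.
  rewrite -(ltn_add2l 1); apply: leq_trans leZ.
  by rewrite (@leq_exp2l 2 1) // subn_gt0.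
by rewrite !inE => /andP[x0 xZ]; exists x; rewrite ?inE.
Qed.
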